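(* Let $T:C^1[0,1]\to C^1[0,1]$ be an isometric reflection of Form (II), i.e. there are $c\in\mathbb{C}$ with $|c|=1$, a continuous function $\beta:[0,1]\to\mathbb{C}$ with $|\beta(t)|=1$ for all $t$, and a homeomorphism $\phi:[0,1]\to[0,1]$ such that $$T(f)(t)=T(0)(t)+c\,\overline{f(0)}+\int_0^t\beta(s)f'(\phi(s))\,ds$$ for every $f\in C^1[0,1]$ and $t\in[0,1]$. Then $\beta(t)\beta(\phi(t))=1$ and $\phi^2(t)=t$ for every $t\in[0,1]$.
   Context: $C^1[0,1]$ is the complex linear space of continuously differentiable complex-valued functions on $[0,1]$ with the norm $\|f\|_\sigma=|f(0)|+\|f'\|_\infty$. An isometry is a map $T$ (not assumed linear) with $\|Tf-Tg\|_\sigma=\|f-g\|_\sigma$ for all $f,g$; it is an isometric reflection if $T^2=T\circ T=I$, the identity map. $T(0)\in C^1[0,1]$ denotes the image of the zero function, and $\phi^2=\phi\circ\phi$. *)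

(* Defs.v *)
From Stdlib Require Import Reals Lra.
From Coquelicot Require Import Coquelicot.

Open Scope R_scope.

Record I01 : Type := mkI01 { I01_val :> R; I01_bounds : 0 <= I01_val <= 1 }.

Definition I01_0 : I01 := mkI01 0 (conj (Rle_refl 0) Rle_0_1).

(* [0,1] carries the metric of R, so that [continuous], [locally] and [locally']
   at a point of [I01] are relative to [0,1] (one-sided at the endpoints). *)
Definition I01_ball (x : I01) (e : R) (y : I01) : Prop :=
  ball (I01_val x) e (I01_val y).

Lemma I01_ball_center (x : I01) (e : posreal) : I01_ball x e x.
Proof. exact (ball_center (I01_val x) e). Qed.

Lemma I01_ball_sym (x y : I01) (e : R) : I01_ball x e y -> I01_ball y e x.
Proof. exact (ball_sym (I01_val x) (I01_val y) e). Qed.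

Lemma I01_ball_triangle (x y z : I01) (e1 e2 : R) :
  I01_ball x e1 y -> I01_ball y e2 z -> I01_ball x (e1 + e2) z.
Proof. exact (ball_triangle (I01_val x) (I01_val y) (I01_val z) e1 e2). Qed.

Definition I01_UniformSpace_mixin : UniformSpace.mixin_of I01 :=
  UniformSpace.Mixin I01 I01_0 I01_ball
    I01_ball_center I01_ball_sym I01_ball_triangle.

Canonical I01_UniformSpace : UniformSpace :=
  UniformSpace.Pack I01 I01_UniformSpace_mixin I01.

Definition is_deriv01 (f : I01 -> C) (t : I01) (l : C) : Prop :=
  filterlim (fun s : I01 => ((f s - f t) / RtoC (s - t))%C)
            (locally' t) (locally l).

(* The value of the derivative, total in the style of [RInt]. *)
Definition deriv01 (f : I01 -> C) (t : I01) : C :=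
  iota (T := C_R_CompleteNormedModule) (is_deriv01 f t).

Definition is_C1 (f : I01 -> C) : Prop :=
  (forall t : I01, exists l : C, is_deriv01 f t l) /\
  (forall t : I01, continuous (deriv01 f) t).

Record C1_01 : Type := mkC1_01 { C1_01_fun :> I01 -> C; C1_01_is_C1 : is_C1 C1_01_fun }.

(* The supremum is finite for continuous [g], so that [real] loses nothing there. *)
Definition sup_norm01 (g : I01 -> C) : R :=
  real (Lub_Rbar (fun r : R => exists t : I01, r = Cmod (g t))).

Definition sigma_norm (f : I01 -> C) : R :=
  Cmod (f I01_0) + sup_norm01 (deriv01 f).

Definition is_isometry (T : C1_01 -> C1_01) : Prop :=
  forall f g : C1_01,
    sigma_norm (fun t => (T f t - T g t)%C) = sigma_norm (fun t => (f t - g t)%C).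

Definition isometric_reflection (T : C1_01 -> C1_01) : Prop :=
  is_isometry T /\ (forall f : C1_01, T (T f) = f).

Lemma locally'_I01_proper (t : I01) : ProperFilter (locally' t).
Proof.
  constructor; [| apply within_filter; apply locally_filter].
  intros P [e He].
  destruct t as [t Ht].
  pose proof (cond_pos e) as Hep.
  assert (Hs : exists s : R, 0 <= s <= 1 /\ s <> t /\ Rabs (s - t) < e).
  { set (d := Rmin (1 / 2) (e / 2)).
    assert (Hd : 0 < d <= 1 / 2 /\ d < e).
    { unfold d, Rmin; destruct (Rle_dec (1 / 2) (e / 2)); lra. }
    destruct (Rle_dec t (1 / 2)).
    - exists (t + d). repeat split; try lra.
      replace (t + d - t) with d by ring. rewrite Rabs_pos_eq; lra.
    - exists (t - d). repeat split; try lra.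
      replace (t - d - t) with (- d) by ring.
      rewrite Rabs_Ropp, Rabs_pos_eq; lra. }
  destruct Hs as [s [Hs [Hne Hd]]].
  exists (mkI01 s Hs). apply He.
  - exact Hd.
  - intros Heq. apply Hne. exact (f_equal I01_val Heq).
Qed.

Lemma deriv01_unique (f : I01 -> C) (t : I01) (l : C) :
  is_deriv01 f t l -> deriv01 f t = l.
Proof.
  intros H.
  apply (@iota_filterlim_locally R_AbsRing C_R_CompleteNormedModule _
           (locally' t) (Proper_StrongProper _ (locally'_I01_proper t)) _ l H).
Qed.

Lemma is_deriv01_zero (t : I01) : is_deriv01 (fun _ => RtoC 0) t (RtoC 0).
Proof.
  apply filterlim_ext with (fun _ : I01 => RtoC 0).
  - intros s. unfold Cdiv, Cminus. now rewrite Cplus_opp_r, Cmult_0_l.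
  - apply filterlim_const.
Qed.

Lemma zero_is_C1 : is_C1 (fun _ => RtoC 0).
Proof.
  split.
  - intros t. exists (RtoC 0). apply is_deriv01_zero.
  - intros t. apply continuous_ext with (fun _ : I01 => RtoC 0).
    + intros s. symmetry. apply deriv01_unique, is_deriv01_zero.
    + apply continuous_const.
Qed.

Definition C1_01_zero : C1_01 := mkC1_01 (fun _ => RtoC 0) zero_is_C1.

Definition homeomorphism01 (phi : I01 -> I01) : Prop :=
  (forall t, continuous phi t) /\
  exists psi : I01 -> I01,
    (forall t, continuous psi t) /\
    (forall t, psi (phi t) = t) /\ (forall t, phi (psi t) = t).

Lemma clamp01_bounds (x : R) : 0 <= Rmax 0 (Rmin x 1) <= 1.
Proof.
  split; [apply Rmax_l | apply Rmax_lub; [lra | apply Rmin_r]].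
Qed.

Definition clamp01 (x : R) : I01 := mkI01 (Rmax 0 (Rmin x 1)) (clamp01_bounds x).

(* [RInt] needs an integrand on R; only its values on [0,t] matter, where
   [clamp01] is the identity. *)
Definition int01 (g : I01 -> C) (t : I01) : C :=
  RInt (V := C_R_CompleteNormedModule) (fun s : R => g (clamp01 s)) 0 t.

(* Main.v *)
Require Import Defs.
From Stdlib Require Import Reals Lra ProofIrrelevance.
From Coquelicot Require Import Coquelicot.

(** Differentiating Form (II) turns [T] into an affine weighted composition
    operator on derivatives:
    (T f)' = (T 0)' + beta * (f' o phi)   ([deriv01_form_II]).
    The term [c * Cconj (f 0)] is constant in t, so it disappears.
    Apply this twice and use T (T f) = f.  Comparing the result for [f] with the
    result for the zero function cancels the contribution of (T 0)' and leaves
    f' (t) = beta t * beta (phi t) * f' (phi (phi t)).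
    By the fundamental theorem of calculus ([is_deriv01_int01]) every continuous
    function on [0,1] is such an f', so
    g (t) = beta t * beta (phi t) * g (phi (phi t)) for every continuous g
    ([form_II_reflection_weighted_comp]).  The choice g = 1 gives
    beta t * beta (phi t) = 1, and then g (s) = s gives phi (phi t) = t. *)

(** * Continuity on the unit interval *)

Lemma I01_eq (s t : I01) : I01_val s = I01_val t -> s = t.
Proof.
  destruct s as [s Hs], t as [t Ht]; simpl; intros <-.
  f_equal; apply proof_irrelevance.
Qed.

Lemma clamp01_id (t : I01) : clamp01 t = t.
Proof.
  apply I01_eq; simpl; destruct (I01_bounds t).
  rewrite Rmin_left by assumption; now apply Rmax_right.
Qed.

Lemma continuous_I01_val (t : I01) : continuous I01_val t.
Proof. intros P [e He]; exists e; intros s; apply He. Qed.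

(** Truncation is 1-Lipschitz. *)
Lemma continuous_clamp01 (x : R) : continuous (U := I01_UniformSpace) clamp01 x.
Proof.
  intros P [e He]; exists e; intros y Hy; apply He.
  revert Hy.
  change (Rabs (y - x) < e ->
          Rabs (Rmax 0 (Rmin y 1) - Rmax 0 (Rmin x 1)) < e).
  apply Rle_lt_trans.
  unfold Rmin; repeat destruct Rle_dec; unfold Rmax; repeat destruct Rle_dec;
    unfold Rabs; repeat destruct Rcase_abs; lra.
Qed.

(** [continuous_mult] concerns the uniform structure of C as an absolute-valued
    ring, whereas C-valued maps here carry the product structure of R * R;
    [locally_C] identifies the two. *)
Lemma continuous_Cmult {U : UniformSpace} (f g : U -> C) (x : U) :
  continuous f x -> continuous g x -> continuous (fun y => (f y * g y)%C) x.
Proof.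
  intros Hf Hg P HP.
  apply (continuous_mult (K := C_AbsRing) f g x).
  - intros Q HQ; apply Hf, locally_C, HQ.
  - intros Q HQ; apply Hg, locally_C, HQ.
  - apply locally_C, HP.
Qed.

(** Each component of the embedding of R in R * R is continuous. *)
Lemma continuous_RtoC (x : R) : continuous RtoC x.
Proof.
  apply (continuous_comp_2 (fun y : R => y) (fun _ : R => 0) (fun a b : R => (a, b))).
  - apply continuous_id.
  - apply continuous_const.
  - apply continuous_ext with (fun p : R * R => p).
    + now intros [].
    + apply continuous_id.
Qed.

(** * The derivative on the unit interval *)

Lemma is_deriv01_plus (f g : I01 -> C) (t : I01) (l m : C) :
  is_deriv01 f t l -> is_deriv01 g t m ->
  is_deriv01 (fun s => (f s + g s)%C) t (l + m)%C.
Proof.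
  intros Hf Hg; unfold is_deriv01.
  eapply filterlim_ext.
  2: exact (filterlim_comp_2 _ _ _ Hf Hg
              (filterlim_plus (V := C_R_NormedModule) l m)).
  intros s; unfold plus; simpl; unfold Cdiv.
  change (((f s - f t) * / (s - t)%R + (g s - g t) * / (s - t)%R)%C =
          ((f s + g s - (f t + g t)) * / (s - t)%R)%C).
  ring.
Qed.

Lemma is_deriv01_const (k : C) (t : I01) : is_deriv01 (fun _ => k) t (RtoC 0).
Proof.
  apply filterlim_ext with (fun _ : I01 => RtoC 0).
  - intros s; unfold Cdiv, Cminus; now rewrite Cplus_opp_r, Cmult_0_l.
  - apply filterlim_const.
Qed.

(** Differentiability on R bounds the remainder F y - F t - (y - t) l by
    eps * |y - t|; dividing by y - t gives the limit of difference quotients,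
    and restricting to [0,1] only shrinks the filter. *)
Lemma is_derive_is_deriv01 (F : R -> C) (t : I01) (l : C) :
  is_derive (V := C_R_NormedModule) F (I01_val t) l ->
  is_deriv01 (fun s => F s) t l.
Proof.
  intros [_ H].
  specialize (H (I01_val t) (fun P HP => HP)).
  apply (filterlim_locally_ball_norm (U := C_R_NormedModule)).
  intros eps.
  (* Half of eps: the derivative gives a weak bound, the ball is open. *)
  destruct (H (pos_div_2 eps)) as [d Hd].
  exists d; intros s Hs Hne.
  specialize (Hd (I01_val s) Hs).
  assert (Hst : (s - t)%R <> 0).
  { intros E; apply Hne, I01_eq; lra. }
  assert (HstC : RtoC (s - t) <> 0%C) by (intros E; apply Hst; now injection E).
  unfold ball_norm.
  match type of Hd with norm ?a <= _ =>
    assert (Ha : a = (((F s - F t) / RtoC (s - t) - l) * RtoC (s - t))%C) end.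
  { rewrite scal_R_Cmult.
    change ((F s - F t - RtoC (s - t) * l)%C =
            (((F s - F t) / RtoC (s - t) - l) * RtoC (s - t))%C).
    field; exact HstC. }
  rewrite Ha, <- Cmod_norm in Hd.
  rewrite <- Cmod_norm.
  change (Cmod ((F s - F t) / RtoC (s - t) - l) < eps).
  change (Cmod (((F s - F t) / RtoC (s - t) - l) * RtoC (s - t))
          <= eps / 2 * Rabs (s - t)) in Hd.
  rewrite Cmod_mult, Cmod_R in Hd.
  apply Rmult_le_reg_r in Hd; [| now apply Rabs_pos_lt].
  pose proof (cond_pos eps); lra.
Qed.

(** The fundamental theorem of calculus.  Composing with [clamp01] extends [g]
    continuously to all of R, so the endpoints need no separate treatment. *)
Lemma is_deriv01_int01 (g : I01 -> C) (t : I01) :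
  (forall s, continuous g s) -> is_deriv01 (int01 g) t (g t).
Proof.
  intros Hg.
  assert (Hh : forall x : R, continuous (fun s : R => g (clamp01 s)) x).
  { intros x; apply (continuous_comp (V := I01_UniformSpace) clamp01 g).
    - apply continuous_clamp01.
    - apply Hg. }
  rewrite <- (clamp01_id t) at 2.
  apply (is_derive_is_deriv01
           (fun x => RInt (V := C_R_CompleteNormedModule)
                       (fun s : R => g (clamp01 s)) 0 x)).
  apply (is_derive_RInt (V := C_R_NormedModule) (fun s : R => g (clamp01 s)) _ 0).
  - apply filter_forall; intros x.
    apply (RInt_correct (V := C_R_CompleteNormedModule)).
    apply (ex_RInt_continuous (V := C_R_CompleteNormedModule)).
    intros z _; apply Hh.
  - apply Hh.
Qed.

Lemma C1_01_is_deriv01 (f : C1_01) (t : I01) : is_deriv01 f t (deriv01 f t).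
Proof.
  destruct (C1_01_is_C1 f) as [Hd _], (Hd t) as [l Hl].
  now rewrite (deriv01_unique _ _ _ Hl).
Qed.

Lemma exists_C1_01_primitive (g : I01 -> C) :
  (forall s, continuous g s) ->
  exists f : C1_01, forall t, deriv01 f t = g t.
Proof.
  intros Hg.
  assert (HC1 : is_C1 (int01 g)).
  { split.
    - intros t; exists (g t); now apply is_deriv01_int01.
    - intros t; apply continuous_ext with g; [| apply Hg].
      intros s; symmetry; now apply deriv01_unique, is_deriv01_int01. }
  exists (mkC1_01 _ HC1); intros t.
  now apply deriv01_unique, is_deriv01_int01.
Qed.

(** * Reflections of Form (II) *)

Section FormII.

Variables (T : C1_01 -> C1_01) (c : C) (beta : I01 -> C) (phi : I01 -> I01).
Hypothesis beta_cont : forall t, continuous beta t.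
Hypothesis phi_cont : forall t, continuous phi t.
Hypothesis T_form_II : forall (f : C1_01) (t : I01),
  T f t = (T C1_01_zero t + c * Cconj (f I01_0)
           + int01 (fun s : I01 => beta s * deriv01 f (phi s)) t)%C.

Lemma deriv01_form_II (f : C1_01) (t : I01) :
  deriv01 (T f) t =
  (deriv01 (T C1_01_zero) t + beta t * deriv01 f (phi t))%C.
Proof.
  apply deriv01_unique.
  apply filterlim_ext with (fun s : I01 =>
    (((T C1_01_zero s + c * Cconj (f I01_0)
       + int01 (fun s : I01 => beta s * deriv01 f (phi s)) s)
      - (T C1_01_zero t + c * Cconj (f I01_0)
       + int01 (fun s : I01 => beta s * deriv01 f (phi s)) t))
     / RtoC (s - t))%C).
  { intros s; now rewrite <- !T_form_II. }
  rewrite <- (Cplus_0_r (deriv01 (T C1_01_zero) t)).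
  apply (is_deriv01_plus (fun s => T C1_01_zero s + c * Cconj (f I01_0))%C).
  - apply (is_deriv01_plus (T C1_01_zero)).
    + apply C1_01_is_deriv01.
    + apply is_deriv01_const.
  - apply (is_deriv01_int01 (fun s => beta s * deriv01 f (phi s))%C).
    intros s; apply continuous_Cmult; [apply beta_cont |].
    apply (continuous_comp phi (deriv01 f)); [apply phi_cont |].
    apply C1_01_is_C1.
Qed.

(** With a = (T 0)', applying the derivative formula twice gives
    h' = a + beta * (a o phi) + beta * (beta o phi) * (h' o phi o phi) for all h.
    Taking h = 0 shows that a + beta * (a o phi) = 0; taking for h a primitive
    of [g] gives the claim. *)
Lemma form_II_reflection_weighted_comp (g : I01 -> C) (t : I01) :
  (forall f, T (T f) = f) -> (forall s, continuous g s) ->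
  g t = (beta t * beta (phi t) * g (phi (phi t)))%C.
Proof.
  intros HTT Hg.
  destruct (exists_C1_01_primitive g Hg) as [f Hf].
  set (a := deriv01 (T C1_01_zero)).
  assert (Hiter : forall h : C1_01, deriv01 h t =
    (a t + beta t * (a (phi t) + beta (phi t) * deriv01 h (phi (phi t))))%C).
  { intros h; rewrite <- (HTT h) at 1.
    now rewrite (deriv01_form_II (T h)), (deriv01_form_II h). }
  assert (Hzero : forall s, deriv01 C1_01_zero s = RtoC 0).
  { intros s; apply deriv01_unique, is_deriv01_zero. }
  assert (Ha : (a t + beta t * a (phi t))%C = RtoC 0).
  { rewrite <- (Hzero t), (Hiter C1_01_zero), Hzero; ring. }
  rewrite <- !Hf, (Hiter f).
  transitivity ((a t + beta t * a (phi t))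
                + beta t * beta (phi t) * deriv01 f (phi (phi t)))%C; [ring |].
  rewrite Ha; ring.
Qed.

End FormII.

Theorem theorem2p2 :
  forall (T : C1_01 -> C1_01) (c : C) (beta : I01 -> C) (phi : I01 -> I01),
    isometric_reflection T ->
    Cmod c = 1%R ->
    (forall t : I01, continuous beta t) ->
    (forall t : I01, Cmod (beta t) = 1%R) ->
    homeomorphism01 phi ->
    (forall (f : C1_01) (t : I01),
       T f t = (T C1_01_zero t + c * Cconj (f I01_0)
                + int01 (fun s : I01 => beta s * deriv01 f (phi s)) t)%C) ->
    forall t : I01, (beta t * beta (phi t))%C = RtoC 1 /\ phi (phi t) = t.
Proof.
  intros T c beta phi [_ HTT] _ Hbeta _ [Hphi _] HT t.
  pose proof (fun g => form_II_reflection_weighted_comp T c beta phi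
                         Hbeta Hphi HT g t HTT) as H.
  assert (Hw : (beta t * beta (phi t))%C = RtoC 1).
  { rewrite (H (fun _ => RtoC 1)); [ring |].
    intros s; apply continuous_const. }
  split; [exact Hw |].
  apply I01_eq; symmetry.
  specialize (H (fun s => RtoC s)).
  rewrite Hw, Cmult_1_l in H.
  apply RtoC_inj, H.
  intros s; apply (continuous_comp I01_val RtoC).
  - apply continuous_I01_val.
  - apply continuous_RtoC.
Qed.
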